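(* Let $\mathcal{L}$ be a Banach Lie algebra. (i) A closed Lie ideal $I$ of $\mathcal{L}$ is strongly $\mathcal{F}$-absorbing if and only if there is a complete, lower finite-gap chain of closed Lie ideals of $\mathcal{L}$ between $I$ and $\mathcal{L}$. (ii) Let $I,J$ be closed Lie ideals of $\mathcal{L}$, $J\subseteq I$ and $\dim(I/J)<\infty$. If $I$ is strongly $\mathcal{F}$-absorbing then $J$ is strongly $\mathcal{F}$-absorbing. (iii) Each complete, lower finite-gap chain $C$ of closed Lie ideals of $\mathcal{L}$ with $\mathfrak{s}(C)=\mathcal{L}$ consists of strongly $\mathcal{F}$-absorbing ideals of $\mathcal{L}$. (iv) The set $\mathrm{Abs}_{\mathcal{F}}^{s}(\mathcal{L})$ is a $\mathfrak{p}$-complete, lower finite-gap family, $\mathfrak{s}(\mathrm{Abs}_{\mathcal{F}}^{s}(\mathcal{L}))=\mathcal{L}$, and $\mathcal{F}_{s}(\mathcal{L})$ is the smallest strongly $\mathcal{F}$-absorbing Lie ideal of $\mathcal{L}$. (v) Let $\mathcal{M}$ be a closed Lie subalgebra of $\mathcal{L}$. If $I\in\mathrm{Abs}_{\mathcal{F}}^{s}(\mathcal{L})$ then $I\cap\mathcal{M}\in\mathrm{Abs}_{\mathcal{F}}^{s}(\mathcal{M})$. (vi) If $\mathcal{L}$ is commutative then $\mathcal{F}_{s}(\mathcal{L})=\{0\}$.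
   Context: A Banach Lie algebra is a complex Lie algebra $\mathcal{L}$ which is a Banach space in a norm such that, for some $t_{\mathcal{L}}>0$, $\|[a,b]\|\leq t_{\mathcal{L}}\|a\|\|b\|$ for all $a,b\in\mathcal{L}$. Quotients by closed Lie ideals carry the quotient norm. For a non-empty family $G$ of closed subspaces of a Banach space, $\mathfrak{p}(G)=\bigcap_{Y\in G}Y$ and $\mathfrak{s}(G)$ is the closed linear span of $\bigcup_{Y\in G}Y$. $G$ is $\mathfrak{p}$-complete if $G=\{\mathfrak{p}(G'):\varnothing\neq G'\subseteq G\}\cup\{\mathfrak{s}(G)\}$; $\mathfrak{s}$-complete if $G=\{\mathfrak{s}(G'):\varnothing\neq G'\subseteq G\}\cup\{\mathfrak{p}(G)\}$; complete means both. $G$ is a lower finite-gap family if for each $Z\in G$ with $Z\neq\mathfrak{p}(G)$ there is $Y\in G$ with $Y\subset Z$ and $0<\dim(Z/Y)<\infty$. A chain is a family $C$ totally ordered by inclusion; it is between $A$ and $B$ if $\mathfrak{p}(C)=A$ and $\mathfrak{s}(C)=B$. $\mathcal{L}$ is strongly $\mathcal{F}$-semisimple if there is a complete, lower finite-gap chain of closed Lie ideals of $\mathcal{L}$ between $\{0\}$ and $\mathcal{L}$. A closed Lie ideal $I$ of $\mathcal{L}$ is strongly $\mathcal{F}$-absorbing if $\mathcal{L}/I$ is strongly $\mathcal{F}$-semisimple; $\mathrm{Abs}_{\mathcal{F}}^{s}(\mathcal{L})$ is the set of all strongly $\mathcal{F}$-absorbing ideals of $\mathcal{L}$, and $\mathcal{F}_{s}(\mathcal{L})=\mathfrak{p}(\mathrm{Abs}_{\mathcal{F}}^{s}(\mathcal{L}))$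 is their intersection. *)

(* Defs.v *)
From HB Require Import structures.
From mathcomp Require Import all_boot all_order all_algebra ring_quotient.
From mathcomp Require Import complex.
From mathcomp Require Import all_classical all_reals all_analysis.

Set Implicit Arguments.
Unset Strict Implicit.
Unset Printing Implicit Defensive.

Import Order.TTheory GRing.Theory Num.Theory.
Import numFieldNormedType.Exports.
Local Open Scope classical_set_scope.
Local Open Scope ring_scope.
Local Open Scope complex_scope.
Local Open Scope quotient_scope.

HB.mixin Record CompleteNormedModule_isBanachLie (K : numFieldType) L
    & CompleteNormedModule K L := {
  lie : L -> L -> L ;
  lieDl : forall x y z : L, lie (x + y) z = lie x z + lie y z ;
  lieDr : forall x y z : L, lie x (y + z) = lie x y + lie x z ;
  lieZl : forall (a : K) (x y : L), lie (a *: x) y = a *: lie x y ;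
  lieZr : forall (a : K) (x y : L), lie x (a *: y) = a *: lie x y ;
  liexx : forall x : L, lie x x = 0 ;
  lie_jacobi : forall x y z : L,
    lie x (lie y z) + lie y (lie z x) + lie z (lie x y) = 0 ;
  lie_bounded : exists2 t : K, 0 < t &
    forall x y : L, `|lie x y| <= t * `|x| * `|y|
}.

#[short(type="banachLieType")]
HB.structure Definition BanachLie (K : numFieldType) :=
  {L of CompleteNormedModule K L & CompleteNormedModule_isBanachLie K L}.

Section subspaces.
Context {K : numFieldType}.

Definition is_subspace (V : lmodType K) (Y : set V) : Prop :=
  Y 0 /\ forall (a : K) x y, Y x -> Y y -> Y (a *: x + y).

Definition closed_subspace (V : normedModType K) (Y : set V) : Prop :=
  is_subspace Y /\ closed Y.

(* [dim_quotient Z Y n] says that dim (Z / Y) = n for subspaces Y `<=` Z: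
   the classes modulo Y of the n vectors e_i of Z form a basis of Z / Y. *)
Definition dim_quotient (V : lmodType K) (Z Y : set V) (n : nat) : Prop :=
  exists e : 'I_n -> V,
  [/\ forall i, Z (e i),
      forall c : 'I_n -> K, Y (\sum_(i < n) c i *: e i) -> forall i, c i = 0 &
      forall z, Z z -> exists c : 'I_n -> K, Y (z - \sum_(i < n) c i *: e i)].

End subspaces.

Section families.
Context {K : numFieldType} {V : normedModType K}.
Implicit Types (G C : set (set V)).

(* p(G) and s(G) *)
Definition fam_cap G : set V := \bigcap_(Y in G) Y.

Definition fam_span G : set V :=
  closure (smallest (@is_subspace K V) (\bigcup_(Y in G) Y)).

Definition p_complete G : Prop :=
  G = [set fam_cap G' | G' in [set G' | G' !=set0 /\ G' `<=` G]]
      `|` [set fam_span G].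

Definition s_complete G : Prop :=
  G = [set fam_span G' | G' in [set G' | G' !=set0 /\ G' `<=` G]]
      `|` [set fam_cap G].

Definition complete_family G : Prop := p_complete G /\ s_complete G.

Definition lower_finite_gap G : Prop :=
  forall Z, G Z -> Z <> fam_cap G ->
  exists Y, [/\ G Y, Y `<` Z & exists2 n, (0 < n)%N & dim_quotient Z Y n].

Definition is_chain C : Prop := C !=set0 /\ total_on C subset.

Definition between (A B : set V) G : Prop := fam_cap G = A /\ fam_span G = B.

End families.

Section lie_substructures.
Context {K : numFieldType} {L : banachLieType K}.

Definition closed_lie_subalgebra (M : set L) : Prop :=
  closed_subspace M /\ forall x y, M x -> M y -> M (lie x y).

(* One-sided, as the bracket is antisymmetric. *)
Definition closed_lie_ideal (I : set L) : Prop :=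
  closed_subspace I /\ forall x y, I y -> I (lie x y).

End lie_substructures.

Record closedLieSubalgebra (K : numFieldType) (L : banachLieType K) :=
  ClosedLieSubalgebra {
    subalgebra_set :> set L ;
    subalgebraP : closed_lie_subalgebra subalgebra_set }.

Record closedLieIdeal (K : numFieldType) (L : banachLieType K) :=
  ClosedLieIdeal {
    ideal_set :> set L ;
    idealP : closed_lie_ideal ideal_set }.

Lemma subspace_submod (K : numFieldType) (V : lmodType K) (Y : set V) :
  is_subspace Y -> GRing.submod_closed (fun x => x \in Y).
Proof.
case=> Y0 Ylin; split; first by rewrite unfold_in; exact: mem_set.
by move=> a x y; rewrite !unfold_in !inE; exact: Ylin.
Qed.

(* The closed Lie subalgebra M as a Banach Lie algebra with the restricted
   norm and bracket. *)
Section subalgebra.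
Context {K : numFieldType} {L : banachLieType K} (M : closedLieSubalgebra L).

Definition subalgebra_pred : {pred L} := fun x => x \in (M : set L).

HB.instance Definition _ := GRing.isSubmodClosed.Build K L subalgebra_pred
  (subspace_submod (subalgebraP M).1.1).

Record subalgebra : Type := Subalgebra {
  subalgebra_val :> L ;
  _ : subalgebra_val \in subalgebra_pred }.

HB.instance Definition _ := [isSub for subalgebra_val].
HB.instance Definition _ := [Choice of subalgebra by <:].
HB.instance Definition _ := [SubChoice_isSubLmodule of subalgebra by <:].

Implicit Types x y z : subalgebra.

Definition subalgebra_norm x : K := `|val x|.

Lemma subalgebra_normD x y :
  subalgebra_norm (x + y) <= subalgebra_norm x + subalgebra_norm y.
Proof. by rewrite /subalgebra_norm raddfD; exact: ler_normD. Qed.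

Lemma subalgebra_normZ (a : K) x :
  subalgebra_norm (a *: x) = `|a| * subalgebra_norm x.
Proof. by rewrite /subalgebra_norm linearZ; exact: normrZ. Qed.

Lemma subalgebra_norm0_eq0 x : subalgebra_norm x = 0 -> x = 0.
Proof. by move=> /normr0_eq0 x0; apply: val_inj; rewrite x0 raddf0. Qed.

HB.instance Definition _ := Lmodule_isNormed.Build K subalgebra
  subalgebra_normD subalgebra_normZ subalgebra_norm0_eq0.

Lemma subalgebra_normE x : `|x| = `|val x|. Proof. by []. Qed.

Lemma subalgebra_mem x : (M : set L) (val x).
Proof. by case: x => x /=; rewrite unfold_in inE. Qed.

Definition subalgebra_of (x : L) (Mx : (M : set L) x) : subalgebra :=
  Sub x (mem_set Mx : x \in subalgebra_pred).

Lemma subalgebra_ofK (x : L) (Mx : (M : set L) x) :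
  val (subalgebra_of Mx) = x.
Proof. exact: SubK. Qed.

Lemma subalgebra_complete (F : set_system subalgebra) :
  ProperFilter F -> cauchy F -> cvg F.
Proof.
move=> FF cF.
have FL : ProperFilter ((val : subalgebra -> L) @ F) by exact: fmap_proper_filter.
have /cauchy_cvg/cvg_ex[/= l Fl] : cauchy ((val : subalgebra -> L) @ F).
  apply: cauchy_exP => e e0.
  have /cauchyP/(_ e e0)[x Fx] := cF.
  exists (val x); suff: F ((val : subalgebra -> L) @^-1` ball (val x) e) by [].
  by apply: filterS Fx => y; rewrite -!ball_normE.
have Ml : (M : set L) l.
  apply: (subalgebraP M).1.2 => B /Fl /= FB.
  have [x Bx] := @filter_ex _ F _ _ FB.
  by exists (val x); split => //; exact: subalgebra_mem.
apply/cvg_ex; exists (subalgebra_of Ml).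
apply/cvgrPdist_lt => e e0.
have /cvgrPdist_lt/(_ e e0) : (val : subalgebra -> L) @ F --> l by [].
by apply: filterS => y.
Qed.

HB.instance Definition _ := Uniform_isComplete.Build subalgebra
  subalgebra_complete.

Definition subalgebra_lie x y : subalgebra :=
  subalgebra_of ((subalgebraP M).2 _ _ (subalgebra_mem x) (subalgebra_mem y)).

Lemma subalgebra_lieE x y : val (subalgebra_lie x y) = lie (val x) (val y).
Proof. exact: subalgebra_ofK. Qed.

Let valD x y : val (x + y) = val x + val y. Proof. exact: raddfD. Qed.

Let valZ (a : K) x : val (a *: x) = a *: val x. Proof. exact: linearZ. Qed.

Lemma subalgebra_lieDl x y z :
  subalgebra_lie (x + y) z = subalgebra_lie x z + subalgebra_lie y z.
Proof. by apply: val_inj; rewrite valD !subalgebra_lieE valD lieDl. Qed.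

Lemma subalgebra_lieDr x y z :
  subalgebra_lie x (y + z) = subalgebra_lie x y + subalgebra_lie x z.
Proof. by apply: val_inj; rewrite valD !subalgebra_lieE valD lieDr. Qed.

Lemma subalgebra_lieZl (a : K) x y :
  subalgebra_lie (a *: x) y = a *: subalgebra_lie x y.
Proof. by apply: val_inj; rewrite valZ !subalgebra_lieE valZ lieZl. Qed.

Lemma subalgebra_lieZr (a : K) x y :
  subalgebra_lie x (a *: y) = a *: subalgebra_lie x y.
Proof. by apply: val_inj; rewrite valZ !subalgebra_lieE valZ lieZr. Qed.

Lemma subalgebra_liexx x : subalgebra_lie x x = 0.
Proof. by apply: val_inj; rewrite subalgebra_lieE liexx raddf0. Qed.

Lemma subalgebra_lie_jacobi x y z :
  subalgebra_lie x (subalgebra_lie y z) + subalgebra_lie y (subalgebra_lie z x)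
  + subalgebra_lie z (subalgebra_lie x y) = 0.
Proof.
by apply: val_inj; rewrite !valD !subalgebra_lieE lie_jacobi raddf0.
Qed.

Lemma subalgebra_lie_bounded : exists2 t : K, 0 < t &
  forall x y, `|subalgebra_lie x y| <= t * `|x| * `|y|.
Proof.
have [t t0 lieB] := @lie_bounded K L; exists t => // x y.
by rewrite !subalgebra_normE subalgebra_lieE; exact: lieB.
Qed.

HB.instance Definition _ := CompleteNormedModule_isBanachLie.Build K subalgebra
  subalgebra_lieDl subalgebra_lieDr subalgebra_lieZl subalgebra_lieZr
  subalgebra_liexx subalgebra_lie_jacobi subalgebra_lie_bounded.

End subalgebra.

(* The Banach Lie algebra L / I with the quotient norm
   |q| = inf {|x| : x in the coset q}. *)
Section quotient.
Context {R : realType} {L : banachLieType R[i]} (I : closedLieIdeal L).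

Definition ideal_pred : {pred L} := fun x => x \in (I : set L).

HB.instance Definition _ := GRing.isSubmodClosed.Build R[i] L ideal_pred
  (subspace_submod (idealP I).1.1).

Definition quotient : Type := Quotient.quot ideal_pred.

HB.instance Definition _ := GRing.Zmodule.on quotient.

Definition quotient_pi (x : L) : quotient := \pi_(Quotient.quot ideal_pred) x.

Implicit Types (x y z : L) (p q r : quotient).

Lemma quotient_piP x y :
  quotient_pi x = quotient_pi y <-> (I : set L) (x - y).
Proof.
have e : (x - y \in ideal_pred) = (quotient_pi x == quotient_pi y).
  exact: Quotient.idealrBE.
by split=> [/eqP|xy]; [|apply/eqP]; rewrite -e unfold_in ?inE// mem_setE.
Qed.

Lemma quotient_pi_surj q : exists x, quotient_pi x = q.
Proof. by exists (repr (q : Quotient.quot ideal_pred)); exact: reprK. Qed.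

Lemma quotient_piD x y : quotient_pi (x + y) = quotient_pi x + quotient_pi y.
Proof. by rewrite /quotient_pi raddfD. Qed.

Lemma quotient_piB x y : quotient_pi (x - y) = quotient_pi x - quotient_pi y.
Proof. by rewrite /quotient_pi raddfB. Qed.

Lemma quotient_pi0 : quotient_pi 0 = 0.
Proof. by rewrite /quotient_pi raddf0. Qed.

Let IZ (a : R[i]) x : (I : set L) x -> (I : set L) (a *: x).
Proof.
by move=> Ix; rewrite -[_ *: _]addr0; apply: (idealP I).1.1.2 => //;
   exact: (idealP I).1.1.1.
Qed.

Let ID x y : (I : set L) x -> (I : set L) y -> (I : set L) (x + y).
Proof. by move=> Ix Iy; rewrite -[x]scale1r; exact: (idealP I).1.1.2. Qed.

Definition quotient_scale (a : R[i]) q : quotient :=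
  quotient_pi (a *: repr (q : Quotient.quot ideal_pred)).

Let repr_piP x : (I : set L) (repr (quotient_pi x : Quotient.quot ideal_pred) - x).
Proof. by apply/quotient_piP; exact: reprK. Qed.

Lemma quotient_piZ (a : R[i]) x :
  quotient_pi (a *: x) = quotient_scale a (quotient_pi x).
Proof.
by apply/esym/quotient_piP; rewrite -scalerBr; apply: IZ; exact: repr_piP.
Qed.

Let pi_ind (P : quotient -> Prop) : (forall x, P (quotient_pi x)) -> forall q, P q.
Proof. by move=> h q; have [x <-] := quotient_pi_surj q. Qed.

Lemma quotient_scaleA (a b : R[i]) q :
  quotient_scale a (quotient_scale b q) = quotient_scale (a * b) q.
Proof. by elim/pi_ind: q => x; rewrite -!quotient_piZ scalerA. Qed.

Lemma quotient_scale1 : left_id 1 quotient_scale.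
Proof. by elim/pi_ind=> x; rewrite -!quotient_piZ scale1r. Qed.

Lemma quotient_scaleDr : right_distributive quotient_scale +%R.
Proof.
move=> a; elim/pi_ind=> x; elim/pi_ind=> y.
by rewrite -!quotient_piZ -!quotient_piD -quotient_piZ scalerDr.
Qed.

Lemma quotient_scaleDl q (a b : R[i]) :
  quotient_scale (a + b) q = quotient_scale a q + quotient_scale b q.
Proof.
by elim/pi_ind: q => x; rewrite -!quotient_piZ -quotient_piD scalerDl.
Qed.

HB.instance Definition _ := GRing.Zmodule_isLmodule.Build R[i] quotient
  quotient_scaleA quotient_scale1 quotient_scaleDr quotient_scaleDl.

Let piZ (a : R[i]) x : quotient_pi (a *: x) = a *: quotient_pi x.
Proof. exact: quotient_piZ. Qed.

Let rn x : R := complex.Re `|x|.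

Let rnE x : (rn x)%:C = `|x|.
Proof. by apply: RRe_real; exact: normr_real. Qed.

Let rn_ge0 x : 0 <= rn x. Proof. by rewrite -ler0c rnE. Qed.

(* The norm of L takes its values in R[i], hence the real part. *)
Definition quotient_rnorm q : R :=
  inf [set complex.Re `|x| | x in [set x | quotient_pi x = q]].

Definition quotient_norm q : R[i] := (quotient_rnorm q)%:C.

Let has_inf_rn q :
  has_inf [set complex.Re `|x| | x in [set x | quotient_pi x = q]].
Proof.
split; first by have [x xq] := quotient_pi_surj q; exists (rn x), x.
by exists 0 => _ [x _ <-]; exact: rn_ge0.
Qed.

Let qn_le x : quotient_rnorm (quotient_pi x) <= rn x.
Proof. by apply: ge_inf; [exact: (has_inf_rn _).2|exists x]. Qed.

Let qn_ge0 q : 0 <= quotient_rnorm q.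
Proof.
by apply: lb_le_inf; [exact: (has_inf_rn q).1|move=> _ [x _ <-]; exact: rn_ge0].
Qed.

Let qn_lt q (e : R) : quotient_rnorm q < e ->
  exists x, quotient_pi x = q /\ rn x < e.
Proof. by case/inf_lt => [|_ [x xq <-] xe]; [exact: (has_inf_rn q).1|exists x]. Qed.

Let le_qn q (a c : R) : 0 <= c ->
  (forall x, quotient_pi x = q -> a <= c * rn x) -> a <= c * quotient_rnorm q.
Proof.
rewrite le_eqVlt => /predU1P[<- h|c0 h].
  by have [x xq] := quotient_pi_surj q; rewrite mul0r -(mul0r (rn x)) h.
rewrite mulrC -ler_pdivrMr//; apply: lb_le_inf; first exact: (has_inf_rn q).1.
by move=> _ [x xq <-]; rewrite ler_pdivrMr// mulrC; exact: h.
Qed.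

Let rnZ (a : R[i]) x : rn (a *: x) = complex.Re `|a| * rn x.
Proof. by apply: complexI; rewrite rmorphM/= !rnE normrZ. Qed.

Let rnD x y : rn (x + y) <= rn x + rn y.
Proof. by rewrite -lecR rmorphD/= !rnE ler_normD. Qed.

Let Re_norm_ge0 (a : R[i]) : 0 <= complex.Re `|a|.
Proof. by rewrite -ler0c RRe_real ?normr_real. Qed.

Lemma quotient_normD p q :
  quotient_norm (p + q) <= quotient_norm p + quotient_norm q.
Proof.
rewrite /quotient_norm -rmorphD/= lecR; apply/ler_addgt0Pr => e e0.
have [x [<- xe]] : exists x, quotient_pi x = p /\ rn x < quotient_rnorm p + e / 2.
  by apply: qn_lt; rewrite ltrDl divr_gt0.
have [y [<- ye]] : exists y, quotient_pi y = q /\ rn y < quotient_rnorm q + e / 2.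
  by apply: qn_lt; rewrite ltrDl divr_gt0.
rewrite -quotient_piD (le_trans (qn_le _))// (le_trans (rnD _ _))//.
by rewrite (splitr e) addrACA lerD// ltW.
Qed.

Let qnZ (a : R[i]) q :
  quotient_rnorm (a *: q) <= complex.Re `|a| * quotient_rnorm q.
Proof.
by apply: le_qn => // x <-; rewrite -piZ -rnZ; exact: qn_le.
Qed.

Lemma quotient_normZ (a : R[i]) q :
  quotient_norm (a *: q) = `|a| * quotient_norm q.
Proof.
rewrite /quotient_norm -[`|a|]RRe_real ?normr_real// -rmorphM; congr _%:C.
apply/eqP; rewrite eq_le qnZ andTb; have [->|a0] := eqVneq a 0.
  by rewrite normr0 mul0r qn_ge0.
have a1 : 0 < complex.Re `|a| by rewrite -ltcR RRe_real ?normr_real ?normr_gt0.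
rewrite mulrC -ler_pdivlMr// mulrC.
have := qnZ a^-1 (a *: q); rewrite scalerA mulVf// scale1r.
suff -> : complex.Re `|a^-1| = (complex.Re `|a|)^-1 by [].
by apply: complexI; rewrite fmorphV !RRe_real ?normr_real// normfV.
Qed.

Lemma quotient_norm0_eq0 q : quotient_norm q = 0 -> q = 0.
Proof.
move=> /complexI q0; have [x xq] := quotient_pi_surj q.
rewrite -xq -quotient_pi0; apply/quotient_piP; rewrite subr0.
apply: (idealP I).1.2 => B /nbhs_ballP[e /= e0 eB].
have [y [yq ye]] : exists y, quotient_pi y = q /\ rn y < complex.Re e.
  by apply: qn_lt; rewrite q0 -ltcR RRe_real// gtr0_real.
exists (x - y); split; first by apply/quotient_piP; rewrite xq yq.
apply: eB; rewrite -ball_normE /= opprB addrC subrK -rnE.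
by rewrite -[e]RRe_real ?gtr0_real// ltcR.
Qed.

HB.instance Definition _ := Lmodule_isNormed.Build R[i] quotient
  quotient_normD quotient_normZ quotient_norm0_eq0.

Lemma quotient_normE q : `|q| = (quotient_rnorm q)%:C. Proof. by []. Qed.

Lemma quotient_norm_pi x : `|quotient_pi x| <= `|x|.
Proof. by rewrite quotient_normE -rnE lecR. Qed.

Lemma quotient_norm_lift q (e : R[i]) : `|q| < e ->
  exists x, quotient_pi x = q /\ `|x| < e.
Proof.
move=> qe; have eR : e = (complex.Re e)%:C.
  by rewrite RRe_real// gtr0_real//; apply: le_lt_trans qe.
move: qe; rewrite eR quotient_normE ltcR => /qn_lt[x [xq xe]].
by exists x; rewrite -rnE ltcR.
Qed.

Lemma quotient_complete (F : set_system quotient) :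
  ProperFilter F -> cauchy F -> cvg F.
Proof.
move=> FF cF; pose h n : R[i] := 2^-1 ^+ n.
have h_gt0 n : 0 < h n by rewrite exprn_gt0// invr_gt0.
have hS n : h n.+1 *+ 2 = h n.
  by rewrite /h exprS -mulrnAl -[_ *+ 2]mulr_natr mulVf ?mul1r.
have h_small (e : R[i]) : 0 < e -> exists n, h n *+ 8 < e.
  move=> e0; have eR : e = (complex.Re e)%:C by rewrite RRe_real// gtr0_real.
  have e0' : 0 < complex.Re e / 8 by rewrite divr_gt0// -ltcR -eR.
  have [n _ /(_ n (leqnn n)) /= hn] := near_infty_natSinv_expn_lt (PosNum e0').
  exists n; rewrite eR -mulr_natr -ltr_pdivlMr// /h.
  have -> : (8 : R[i]) = (8 : R)%:C by rewrite rmorph_nat.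
  have -> : (2^-1 : R[i]) = (2^-1 : R)%:C by rewrite fmorphV/= rmorph_nat.
  rewrite -fmorphV -rmorphM -rmorphXn/= ltcR.
  by move: hn; rewrite /= div1r exprVn.
have [qs Fqs] : {qs : nat -> quotient & forall n, F (ball (qs n) (h n))}.
  apply: (@choice _ _ (fun n q => F (ball q (h n)))) => n.
  by have /cauchyP/(_ _ (h_gt0 n)) := cF.
have qs_dist n : `|qs n.+1 - qs n| < h n *+ 2.
  have [r []] := @filter_ex _ F _ _ (filterI (Fqs n.+1) (Fqs n)).
  rewrite -!ball_normE /= => rS rn'.
  rewrite -(subrKA r) (le_lt_trans (ler_normD _ _))// mulr2n ltrD//.
    by rewrite (lt_trans rS)// -(hS n) mulr2n ltrDl.
  by rewrite distrC.
have [d dP] : {d : nat -> L & forall n,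
    quotient_pi (d n) = qs n.+1 - qs n /\ `|d n| < h n *+ 2}.
  apply: (@choice _ _ (fun n x =>
    quotient_pi x = qs n.+1 - qs n /\ `|x| < h n *+ 2)) => n.
  exact: quotient_norm_lift.
have [x0 x0q] := quotient_pi_surj (qs 0%N).
pose X n := x0 + \sum_(i < n) d i.
have XS n : X n.+1 = X n + d n by rewrite /X big_ord_recr addrA.
have XP n : quotient_pi (X n) = qs n.
  elim: n => [|n IHn]; first by rewrite /X big_ord0 addr0.
  by rewrite XS quotient_piD IHn (dP n).1 addrC subrK.
have X_dist n k : `|X (n + k)%N - X n| + h (n + k)%N *+ 4 <= h n *+ 4.
  elim: k => [|k IHk]; first by rewrite addn0 subrr normr0 add0r.
  apply: le_trans IHk; rewrite addnS XS addrAC (mulrnA _ 2 2) hS.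
  rewrite (le_trans (lerD (ler_normD _ _) (lexx _)))// -addrA lerD2l.
  by rewrite (mulrnDr _ 2 2) lerD2r ltW// (dP _).2.
have X_le n m : (n <= m)%N -> `|X m - X n| <= h n *+ 4.
  move=> /subnKC <-; apply: le_trans (X_dist n (m - n)%N).
  by rewrite lerDl mulrn_wge0// ltW.
have /cauchy_cvg/cvg_ex[/= x Xx] : cauchy (X @ \oo).
  apply: cauchy_exP => e /h_small[n ne]; exists (X n), n => // m /= nm.
  rewrite -ball_normE /= distrC (le_lt_trans (X_le _ _ nm))//.
  by rewrite (le_lt_trans _ ne)// ler_wpMn2l// ltW.
apply/cvg_ex; exists (quotient_pi x); apply/cvgrPdist_lt => e /h_small[n ne].
have xXn : `|x - X n| < h n + h n *+ 4.
  have /cvgrPdist_lt/(_ _ (h_gt0 n))[m _ mX] := Xx.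
  rewrite -(subrKA (X (maxn n m))) (le_lt_trans (ler_normD _ _))//.
  by rewrite ltr_leD ?X_le ?leq_maxl// mX//= leq_maxr.
apply: (@filterS _ F _ _ _ _ (Fqs n)) => r; rewrite -ball_normE /= => qr.
rewrite -(subrKA (qs n)) (le_lt_trans (ler_normD _ _))//.
apply: lt_le_trans (ltW ne); rewrite -XP -quotient_piB in qr *.
apply: (@lt_le_trans _ _ (h n *+ 5 + h n)); last first.
  by rewrite -mulrSr ler_wpMn2l// ltW.
by rewrite ltrD// (le_lt_trans (quotient_norm_pi _))// mulrS.
Qed.

HB.instance Definition _ := Uniform_isComplete.Build quotient quotient_complete.

Definition quotient_lie p q : quotient :=
  quotient_pi (lie (repr (p : Quotient.quot ideal_pred))
                   (repr (q : Quotient.quot ideal_pred))).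

Let lieNl x y : lie (- x) y = - lie x y.
Proof. by rewrite -scaleN1r lieZl scaleN1r. Qed.

Let lieNr x y : lie x (- y) = - lie x y.
Proof. by rewrite -scaleN1r lieZr scaleN1r. Qed.

Let lieC x y : lie x y = - lie y x.
Proof.
have := liexx (x + y); rewrite lieDl !lieDr !liexx add0r addr0.
by move/eqP; rewrite addr_eq0 => /eqP.
Qed.

Lemma quotient_pi_lie x y :
  quotient_pi (lie x y) = quotient_lie (quotient_pi x) (quotient_pi y).
Proof.
apply/esym/quotient_piP.
set x' := repr _; set y' := repr _.
have -> : lie x' y' - lie x y = lie x' (y' - y) + lie y (x - x').
  rewrite (lieC y) lieDr lieNr lieDl lieNl opprD opprK addrACA.
  by rewrite addNr addr0.
by apply: ID; apply: (idealP I).2; [|rewrite -opprB -scaleN1r; apply: IZ];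
  exact: repr_piP.
Qed.

Lemma quotient_lieDl p q r :
  quotient_lie (p + q) r = quotient_lie p r + quotient_lie q r.
Proof.
elim/pi_ind: p => x; elim/pi_ind: q => y; elim/pi_ind: r => z.
by rewrite -quotient_piD -!quotient_pi_lie lieDl quotient_piD.
Qed.

Lemma quotient_lieDr p q r :
  quotient_lie p (q + r) = quotient_lie p q + quotient_lie p r.
Proof.
elim/pi_ind: p => x; elim/pi_ind: q => y; elim/pi_ind: r => z.
by rewrite -quotient_piD -!quotient_pi_lie lieDr quotient_piD.
Qed.

Lemma quotient_lieZl (a : R[i]) p q :
  quotient_lie (a *: p) q = a *: quotient_lie p q.
Proof.
elim/pi_ind: p => x; elim/pi_ind: q => y.
by rewrite -piZ -!quotient_pi_lie lieZl piZ.
Qed.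

Lemma quotient_lieZr (a : R[i]) p q :
  quotient_lie p (a *: q) = a *: quotient_lie p q.
Proof.
elim/pi_ind: p => x; elim/pi_ind: q => y.
by rewrite -piZ -!quotient_pi_lie lieZr piZ.
Qed.

Lemma quotient_liexx p : quotient_lie p p = 0.
Proof. by elim/pi_ind: p => x; rewrite -quotient_pi_lie liexx quotient_pi0. Qed.

Lemma quotient_lie_jacobi p q r :
  quotient_lie p (quotient_lie q r) + quotient_lie q (quotient_lie r p)
  + quotient_lie r (quotient_lie p q) = 0.
Proof.
elim/pi_ind: p => x; elim/pi_ind: q => y; elim/pi_ind: r => z.
by rewrite -!quotient_pi_lie -!quotient_piD lie_jacobi quotient_pi0.
Qed.

Lemma quotient_lie_bounded : exists2 t : R[i], 0 < t &
  forall p q, `|quotient_lie p q| <= t * `|p| * `|q|.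
Proof.
have [t t0 lieB] := @lie_bounded R[i] L; exists t => // p q.
have tR : t = (complex.Re t)%:C by rewrite RRe_real// gtr0_real.
have tR0 : 0 <= complex.Re t by rewrite -ler0c -tR ltW.
rewrite tR !quotient_normE -!rmorphM/= lecR.
apply: le_qn => [|y <-]; first by rewrite mulr_ge0.
rewrite mulrAC; apply: le_qn => [|x <-]; first by rewrite mulr_ge0.
rewrite -quotient_pi_lie (le_trans (qn_le _))// mulrAC.
by rewrite -lecR !rmorphM/= !rnE -tR lieB.
Qed.

HB.instance Definition _ := CompleteNormedModule_isBanachLie.Build R[i] quotient
  quotient_lieDl quotient_lieDr quotient_lieZl quotient_lieZr
  quotient_liexx quotient_lie_jacobi quotient_lie_bounded.

End quotient.

Section strongly_F_semisimple.
Context {K : numFieldType}.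
Implicit Types L : banachLieType K.

Definition complete_lfg_chain L (C : set (set L)) : Prop :=
  [/\ is_chain C, C `<=` closed_lie_ideal, complete_family C &
      lower_finite_gap C].

Definition strongly_F_semisimple L : Prop :=
  exists2 C : set (set L), complete_lfg_chain C & between [set 0] setT C.

End strongly_F_semisimple.

Section strongly_F_absorbing.
Context {R : realType}.

Definition strongly_F_absorbing (L : banachLieType R[i]) (I : set L) : Prop :=
  exists hI : closed_lie_ideal I,
    strongly_F_semisimple (quotient (ClosedLieIdeal hI)).

Definition Abs_Fs (L : banachLieType R[i]) : set (set L) :=
  [set I | strongly_F_absorbing I].
Arguments Abs_Fs L : clear implicits.

Definition Fs (L : banachLieType R[i]) : set L := fam_cap (Abs_Fs L).

End strongly_F_absorbing.

Arguments Abs_Fs {R} L _.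
Arguments Fs {R} L _.

(* Main.v *)
(* An ideal I turns out to be strongly F-absorbing exactly when every subset Z
   of L not contained in I lies in some closed ideal V, but not in some closed
   ideal W containing I with dim (V / W) finite. This property of I involves no
   chain; it is stable under intersections, finite-codimensional closed
   subideals, preimages and quotients, whence (ii), (iv) and (v).
   - If I belongs to a complete lower finite-gap chain reaching up to L, take
     for V the intersection of the members of the chain that contain Z, and for
     W the larger of I and a member of the chain of finite codimension in V.
   - Conversely, the property attaches to each closed ideal Y strictly
     containing I a closed ideal between I and Y of finite nonzero codimension
     in Y; iterating transfinitely from L, with intersections at limit stages
     (a Bourbaki-Witt tower), gives a chain between I and L.
   In the commutative case every closed subspace is an ideal, and the
   Hahn-Banach theorem provides closed hyperplanes avoiding any given nonzero
   vector. *)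
From HB Require Import structures.
Require Import Defs.
From mathcomp Require Import all_boot all_order all_algebra complex.
From mathcomp Require Import all_classical all_reals all_analysis.

Import Order.TTheory GRing.Theory Num.Theory.
Import numFieldNormedType.Exports.
Local Open Scope classical_set_scope.
Local Open Scope ring_scope.
Local Open Scope complex_scope.

Set Implicit Arguments.
Unset Strict Implicit.
Unset Printing Implicit Defensive.

(** * The Hahn-Banach theorem for sublinear functionals *)

Section hahn_banach.
Context {R : realType} {E : lmodType R[i]}.
Implicit Types (p q : E -> R) (x y z : E).

Definition sublinear p : Prop :=
  (forall x y, p (x + y) <= p x + p y) /\
  (forall (t : R) x, 0 < t -> p (t%:C *: x) <= t * p x).

Lemma sublinearZ p (t : R) x : sublinear p -> 0 < t ->
  p (t%:C *: x) = t * p x.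
Proof.
move=> [_ pZ] t0; apply/eqP; rewrite eq_le pZ//= -ler_pdivlMl//.
rewrite -[x in p x]scale1r.
have -> : 1 = t^-1%:C * t%:C by rewrite -rmorphM/= mulVf// gt_eqF.
by rewrite -scalerA pZ// invr_gt0.
Qed.

Lemma sublinear0 p : sublinear p -> p 0 = 0.
Proof.
move=> sp; have := @sublinearZ p 2 0 sp; rewrite scaler0 => /(_ ltac:(by [])).
by move/eqP; rewrite mulrDl mul1r -subr_eq0 opprD addrA subrr sub0r oppr_eq0 => /eqP.
Qed.

Lemma sublinear_ge_opp p x : sublinear p -> - p (- x) <= p x.
Proof.
move=> sp; have := sp.1 x (- x); rewrite subrr sublinear0// => h.
by rewrite -subr_ge0 opprK.
Qed.

(* The infimum over [t >= 0] of [p (x + t y) - t p y]: the largest sublinear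
   minorant of [p] that takes the value [- p y] at [- y]. *)
Definition lower_along p y x : R :=
  inf [set p (x + t%:C *: y) - t * p y | t in [set t : R | 0 <= t]].

Lemma lower_along_has_inf p y x : sublinear p ->
  has_inf [set p (x + t%:C *: y) - t * p y | t in [set t : R | 0 <= t]].
Proof.
move=> sp; split; first by exists (p (x + 0%:C *: y) - 0 * p y), 0 => //=.
exists (- p (- x)) => _ [t /= t0 <-].
have -> : t * p y = p (t%:C *: y).
  move: t0; rewrite le_eqVlt => /predU1P[<-|t0]; last by rewrite sublinearZ.
  by rewrite mul0r scale0r sublinear0.
rewrite lerBrDr addrC lerBlDr.
by apply: le_trans (sp.1 _ _); rewrite addrAC subrr add0r.
Qed.

Lemma lower_along_le p y x (t : R) : sublinear p -> 0 <= t ->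
  lower_along p y x <= p (x + t%:C *: y) - t * p y.
Proof.
by move=> sp t0; apply: ge_inf; [exact: (lower_along_has_inf _ _ sp).2|exists t].
Qed.

Lemma lower_along_lt p y x (e : R) : sublinear p -> lower_along p y x < e ->
  exists2 t : R, 0 <= t & p (x + t%:C *: y) - t * p y < e.
Proof.
move=> sp /inf_lt[|_ [t t0 <-] te]; first exact: (lower_along_has_inf _ _ sp).1.
by exists t.
Qed.

Lemma lower_along_minorant p y x : sublinear p -> lower_along p y x <= p x.
Proof.
move=> sp; have := lower_along_le y x sp (lexx 0).
by rewrite scale0r addr0 mul0r subr0.
Qed.

(** Nearly optimal parameters [t1], [t2] for two points give [t1 + t2] for their sum; likewise [t]
    at [x] gives [s * t] at [s x]. *)
Lemma lower_along_sublinear p y : sublinear p -> sublinear (lower_along p y).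
Proof.
move=> sp; split=> [x1 x2|s x s0].
  apply/ler_addgt0Pr => e e0.
  have [t1 t10 h1] : exists2 t : R, 0 <= t &
      p (x1 + t%:C *: y) - t * p y < lower_along p y x1 + e / 2.
    by apply: lower_along_lt => //; rewrite ltrDl divr_gt0.
  have [t2 t20 h2] : exists2 t : R, 0 <= t &
      p (x2 + t%:C *: y) - t * p y < lower_along p y x2 + e / 2.
    by apply: lower_along_lt => //; rewrite ltrDl divr_gt0.
  apply: le_trans (lower_along_le y _ sp (addr_ge0 t10 t20)) _.
  rewrite rmorphD scalerDl addrACA mulrDl opprD (splitr e).
  rewrite [leRHS]addrACA; apply: le_trans (ltW (ltrD h1 h2)).
  by rewrite [leRHS]addrACA lerD2r sp.1.
apply/ler_addgt0Pr => e e0.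
have [t t0 h] : exists2 t : R, 0 <= t &
    p (x + t%:C *: y) - t * p y < lower_along p y x + e / s.
  by apply: lower_along_lt => //; rewrite ltrDl divr_gt0.
apply: le_trans (lower_along_le y _ sp (mulr_ge0 (ltW s0) t0)) _.
rewrite rmorphM/= -scalerA -scalerDr sublinearZ// -mulrA -mulrBr.
rewrite -[e](divfK (lt0r_neq0 s0)) [_ / _ * s]mulrC -mulrDr ler_pM2l//.
exact: ltW.
Qed.

(** A minimal [p] lies below its own lowering along [y]; the term [t = 1] of that infimum is
    [p (x + y) - p y], whence superadditivity. *)
Lemma minimal_sublinear_additive p : sublinear p ->
  (forall q, sublinear q -> (forall x, q x <= p x) -> forall x, p x <= q x) ->
  {morph p : x y / x + y}.
Proof.
move=> sp pmin x y; apply/eqP; rewrite eq_le sp.1/=.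
have := pmin _ (lower_along_sublinear y sp)
  (fun x => lower_along_minorant y x sp) x.
move=> /le_trans/(_ (lower_along_le y x sp ler01)).
by rewrite scale1r mul1r lerBrDr.
Qed.

(** Zorn's lemma for the reversed pointwise order: the pointwise infimum of a chain of minorants,
    bounded below by [- p (- x)], is again sublinear. *)
Lemma minimal_sublinear_exists p : sublinear p ->
  exists q, [/\ sublinear q, forall x, q x <= p x &
    forall r, sublinear r -> (forall x, r x <= q x) -> forall x, q x <= r x].
Proof.
move=> sp.
pose below q := sublinear q /\ forall x, q x <= p x.
pose T := {q : E -> R | below q}.
pose leT (q r : T) := `[< forall x, sval r x <= sval q x >].
have [|q r s /asboolP qr /asboolP rs|q r /asboolP qr /asboolP rq|A Atot|q qmin]
  := @Zorn T leT.
- by move=> q; apply/asboolP.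
- by apply/asboolP => x; exact: le_trans (rs x) (qr x).
- case: q qr rq => q qP; case: r => r rP /= qr rq.
  apply: eq_exist => /=; apply/funext => x; apply/eqP.
  by rewrite eq_le qr rq.
- have [->|/set0P[a Aa]] := eqVneq A set0.
    by exists (exist below p (conj sp (fun x => lexx (p x)))).
  pose S x := [set sval q x | q in A].
  have hinf x : has_inf (S x).
    split; first by exists (sval a x), a.
    exists (- p (- x)) => _ [q _ <-]; have [sq qp] := svalP q.
    by apply: le_trans (sublinear_ge_opp x sq); rewrite lerN2.
  have inf_le (q : T) x : A q -> inf (S x) <= sval q x.
    by move=> Aq; apply: ge_inf; [exact: (hinf x).2|exists q].
  have inf_ex x e : 0 < e -> exists2 q, A q & sval q x < inf (S x) + e.
    move=> e0; have : inf (S x) < inf (S x) + e by rewrite ltrDl.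
    by case/inf_lt => [|_ [q Aq <-] qe]; [exact: (hinf x).1|exists q].
  have sinf : sublinear (fun x => inf (S x)).
    split=> [x y|t x t0]; apply/ler_addgt0Pr => e e0.
      have [q Aq qx] := inf_ex x _ (divr_gt0 e0 (ltr0Sn _ 1)).
      have [r Ar ry] := inf_ex y _ (divr_gt0 e0 (ltr0Sn _ 1)).
      have [m [Am mq mr]] : exists m, [/\ A m, sval m x <= sval q x &
          sval m y <= sval r y].
        by have [/asboolP h|/asboolP h] := Atot _ _ Aq Ar;
          [exists r|exists q].
      apply: le_trans (inf_le _ (x + y) Am) _.
      apply: le_trans ((svalP m).1.1 x y) _.
      rewrite (splitr e) addrACA lerD//; first exact: le_trans mq (ltW qx).
      exact: le_trans mr (ltW ry).
    have [q Aq qx] := inf_ex x _ (divr_gt0 e0 t0).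
    apply: le_trans (inf_le _ _ Aq) _; rewrite (sublinearZ _ (svalP q).1)//.
    rewrite -[e](divfK (lt0r_neq0 t0)) [_ / _ * t]mulrC -mulrDr ler_pM2l//.
    exact: ltW.
  have infp x : inf (S x) <= p x.
    exact: le_trans (inf_le _ x Aa) ((svalP a).2 x).
  exists (exist below _ (conj sinf infp)) => q Aq.
  by apply/asboolP => x /=; exact: inf_le.
- exists (sval q); have [sq qp] := svalP q; split=> // r sr rq.
  have rp x : r x <= p x by exact: le_trans (rq x) (qp x).
  have := qmin (exist below r (conj sr rp)).
  have -> : leT q (exist below r (conj sr rp)) by apply/asboolP.
  by move=> /(_ isT) <- x.
Qed.

(** A minimal sublinear [f] below [lower_along p z] is additive, and [f (- z) <= - p z] forces
    [f z = p z]. *)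
Lemma hahn_banach_at p z : sublinear p ->
  exists f, [/\ {morph f : x y / x + y},
    forall (t : R) x, f (t%:C *: x) = t * f x,
    forall x, f x <= p x & f z = p z].
Proof.
move=> sp.
have [f [sf fp fmin]] := minimal_sublinear_exists (lower_along_sublinear z sp).
have fD := minimal_sublinear_additive sf fmin.
have fN x : f (- x) = - f x.
  by apply/eqP; rewrite -addr_eq0 -fD addNr sublinear0.
have fle x : f x <= p x by exact: le_trans (fp x) (lower_along_minorant z x sp).
exists f; split=> //.
  move=> t x; have [t0|t0|->] := ltgtP t 0.
  - rewrite -[t]opprK rmorphN/= scaleNr fN sublinearZ// ?oppr_gt0//.
    by rewrite !mulNr.
  - exact: sublinearZ.
  - by rewrite scale0r mul0r sublinear0.
apply/eqP; rewrite eq_le fle/= -lerN2 -fN.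
apply: le_trans (fp _) (le_trans (lower_along_le z _ sp ler01) _).
by rewrite scale1r addNr sublinear0// sub0r mul1r.
Qed.

End hahn_banach.

Lemma closed_hyperplane_avoiding (R : realType) (E : normedModType R[i]) (z : E) :
  z != 0 -> exists W : set E,
    [/\ closed_subspace W, ~ W z & dim_quotient setT W 1].
Proof.
move=> z0; pose N (x : E) : R := complex.Re `|x|.
have NE x : (N x)%:C = `|x| by apply: RRe_real; exact: normr_real.
have sN : sublinear N.
  split=> [x y|t x t0]; rewrite -lecR !(rmorphD, rmorphM)/= !NE.
    exact: ler_normD.
  by rewrite normrZ ger0_norm// ler0c ltW.
have [f [fD fZ fN fz]] := hahn_banach_at z sN.
(* [f] is only real-linear; [g] is the complex-linear functional with real part [f]. *)
pose g (x : E) : R[i] := f x +i* - f ('i *: x).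
have gD : {morph g : x y / x + y}.
  by move=> x y; rewrite /g scalerDr !fD opprD.
have fNx x : f (- x) = - f x.
  have -> : - x = (-1)%:C *: x by rewrite rmorphN scaleN1r.
  by rewrite fZ mulN1r.
have gZ a x : g (a *: x) = a * g x.
  case: a => a b; have -> : a +i* b = a%:C + b%:C * 'i by simpc.
  have -> : (a%:C + b%:C * 'i) *: x = a%:C *: x + b%:C *: ('i *: x).
    by rewrite scalerDl scalerA.
  have -> : g (a%:C *: x + b%:C *: ('i *: x)) =
      (a * f x + b * f ('i *: x)) +i* - (a * f ('i *: x) - b * f x).
    rewrite /g scalerDr !fD !fZ; congr (_ +i* - (_ + _)).
      by rewrite scalerA mulrC -scalerA fZ.
    rewrite !scalerA mulrAC -expr2 sqr_i mulN1r scaleNr fNx fZ.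
    by [].
  by rewrite /g; simpc; congr (_ +i* _); rewrite addrC.
have gB x y : g (x - y) = g x - g y by rewrite -scaleN1r gD gZ mulN1r.
have gz : g z != 0.
  apply/eqP => /(congr1 (@complex.Re R)) /= /eqP; rewrite fz.
  by rewrite -(inj_eq (@complexI R)) NE normr_eq0 (negPf z0).
exists [set x | g x = 0]; split.
- split; first split=> /= [|a x y gx gy].
  + by rewrite -(scale0r 0) gZ mul0r.
  + by rewrite gD gZ gx gy mulr0 addr0.
  (* If [g y = 0] then [f (s y) = 0], so [f (s x)] is at most the norm of [x - y], which is
     arbitrarily small. Using [s] and [- s] for [s = 1] and [s = 'i] gives [g x = 0]. *)
  move=> x clx; have f_le0 s : `|s| = 1 -> f (s *: x) <= 0.
    move=> s1; apply/ler_addgt0Pr => e e0; rewrite add0r.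
    have e0' : 0 < e%:C by rewrite -[0]/(0%:C) ltcR.
    have [y [/= gy]] := clx _ (nbhsx_ballx x _ e0'); rewrite -ball_normE /= => xy.
    have fsy : f (s *: y) = 0 by have := gZ s y; rewrite gy mulr0 => -[].
    rewrite -(subrK (s *: y) (s *: x)) fD fsy addr0 -scalerBr.
    apply: le_trans (fN _) _; rewrite -lecR NE normrZ s1 mul1r; exact: ltW.
  have f_eq0 s : `|s| = 1 -> f (s *: x) = 0.
    move=> s1; apply/eqP; rewrite eq_le f_le0//= -oppr_le0 -fNx -scaleNr.
    by rewrite f_le0// normrN.
  have fi : f ('i *: x) = 0 by rewrite f_eq0// normCi.
  have fx : f x = 0 by rewrite -[x]scale1r f_eq0// normr1.
  by rewrite /= /g fi fx oppr0.
- by apply/eqP.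
- exists (fun=> z); split=> // [c|x _].
    rewrite /= big_ord1 gZ => /eqP; rewrite mulf_eq0 (negPf gz) orbF => /eqP c0 i.
    by rewrite ord1.
  exists (fun=> g x / g z); rewrite /= big_ord1 gB gZ divfK// subrr//.
Qed.

(** * Subspaces and finite codimension *)

Section subspace_theory.
Context {K : numFieldType} {V : lmodType K}.
Implicit Types (Y Z : set V).

Lemma is_subspace0 Y : is_subspace Y -> Y 0.
Proof. by case. Qed.

Lemma is_subspaceZ Y (a : K) x : is_subspace Y -> Y x -> Y (a *: x).
Proof. by move=> [Y0 Ylin] Yx; rewrite -[_ *: _]addr0; exact: Ylin. Qed.

Lemma is_subspaceD Y x y : is_subspace Y -> Y x -> Y y -> Y (x + y).
Proof. by move=> [_ Ylin] Yx Yy; rewrite -[x]scale1r; exact: Ylin. Qed.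

Lemma is_subspaceB Y x y : is_subspace Y -> Y x -> Y y -> Y (x - y).
Proof.
move=> sY Yx Yy; apply: is_subspaceD => //.
by rewrite -scaleN1r; exact: is_subspaceZ.
Qed.

Lemma is_subspace_sum Y n (c : 'I_n -> K) (e : 'I_n -> V) : is_subspace Y ->
  (forall i, Y (e i)) -> Y (\sum_(i < n) c i *: e i).
Proof.
move=> sY Ye; apply: (big_ind Y) => [|x y|i _]; first exact: is_subspace0.
  exact: is_subspaceD.
exact: is_subspaceZ.
Qed.

Lemma is_subspaceI Y Z :
  is_subspace Y -> is_subspace Z -> is_subspace (Y `&` Z).
Proof.
move=> [Y0 Yl] [Z0 Zl]; split=> // a x y [Yx Zx] [Yy Zy].
by split; [exact: Yl|exact: Zl].
Qed.

(** A family in [Z] of maximal length among those free modulo [Y] generates [Z] modulo [Y], as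
    otherwise one more vector could be adjoined. *)
Lemma dim_quotient_bound Z Y n : is_subspace Z -> is_subspace Y ->
  (forall k (e : 'I_k -> V), (forall i, Z (e i)) ->
     (forall c : 'I_k -> K, Y (\sum_(i < k) c i *: e i) -> forall i, c i = 0) ->
     (k <= n)%N) ->
  exists m, dim_quotient Z Y m.
Proof.
move=> sZ sY bound.
pose free k := `[< exists2 e : 'I_k -> V, (forall i, Z (e i)) &
  forall c : 'I_k -> K, Y (\sum_(i < k) c i *: e i) -> forall i, c i = 0 >].
have free0 : exists k, free k.
  by exists 0%N; apply/asboolP; exists (fun=> 0) => [i|c _ i]; case: i.
have free_le k : free k -> (k <= n)%N by move=> /asboolP[e]; exact: bound.
case: (ex_maxnP free0 free_le) => m /asboolP[e Ze efree] mmax.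
exists m, e; split=> // z Zz; apply: contrapT => ngen.
suff : free m.+1 by move=> /mmax; rewrite ltnn.
apply/asboolP.
exists (fun i => if unlift ord0 i is Some j then e j else z) => [i|c].
  by case: unliftP => [j|] _.
rewrite big_ord_recl unlift_none.
under eq_bigr do rewrite liftK.
move=> Yc; have c0 : c ord0 = 0.
  apply: contrapT => /eqP c0; apply: ngen.
  exists (fun i => - ((c ord0)^-1 * c (lift ord0 i))).
  under eq_bigr do rewrite scaleNr -scalerA.
  rewrite sumrN opprK -scaler_sumr -[z in z + _](scalerK c0) -scalerDr.
  exact: is_subspaceZ.
move: Yc; rewrite c0 scale0r add0r => /efree c0' i.
by case: (unliftP ord0 i) => [j ->|->].
Qed.

End subspace_theory.

(** More than [n] vectors of [Z] have images dependent modulo [B], hence are themselves dependent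
    modulo [W]. *)
Lemma dim_quotient_preimage (K : numFieldType) (U V : lmodType K)
    (f : {linear U -> V}) (Z W : set U) (A B : set V) n :
  is_subspace Z -> is_subspace W -> is_subspace B ->
  Z `<=` f @^-1` A -> Z `&` f @^-1` B `<=` W ->
  dim_quotient A B n -> exists m, dim_quotient Z W m.
Proof.
move=> sZ sW sB ZA ZBW [b [_ _ bgen]].
apply: (@dim_quotient_bound _ _ _ _ n) => // k e Ze efree.
have /choice[c cP] : forall i, exists c : 'I_n -> K,
    B (f (e i) - \sum_(j < n) c j *: b j).
  by move=> i; apply: bgen; exact: ZA.
rewrite leqNgt; apply/negP => nk.
pose M := \matrix_(i < k, j < n) c i j.
(* There are more rows than columns, so some non-zero [d] annihilates [M]; the combination of the
   [e i] with coefficients [d] is then sent into [B]. *)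
have /rowV0Pn[d /sub_kermxP dM d0] : kermx M != 0.
  rewrite kermx_eq0 -row_leq_rank -ltnNge.
  exact: leq_ltn_trans (rank_leq_col _) nk.
case/eqP: d0; apply/rowP => i; rewrite mxE.
apply: (efree (d 0)) => {i}; apply: ZBW; split; first exact: is_subspace_sum.
rewrite /= linear_sum.
have -> : \sum_(i < k) f (d 0 i *: e i) =
    \sum_(i < k) d 0 i *: (f (e i) - \sum_(j < n) c i j *: b j).
  under [RHS]eq_bigr do rewrite scalerBr scaler_sumr.
  rewrite sumrB exchange_big /= [X in _ - X]big1 ?subr0 => [|j _].
    by apply: eq_bigr => i _; rewrite linearZ.
  under eq_bigr do rewrite scalerA.
  rewrite -scaler_suml.
  have -> : \sum_(i < k) d 0 i * c i j = (d *m M) 0 j.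
    by rewrite mxE; apply: eq_bigr => i _; rewrite mxE.
  by rewrite dM mxE scale0r.
exact: is_subspace_sum.
Qed.

Lemma dim_quotient_gt0 (K : numFieldType) (V : lmodType K) (Z Y : set V) n :
  ~ Z `<=` Y -> dim_quotient Z Y n -> (0 < n)%N.
Proof.
case: n => // ZY [e [_ _ gen]]; case: ZY => z /gen[c].
by rewrite big_ord0 subr0.
Qed.

(* [Z] is an arbitrary subset, not just a closed ideal, so that the property
   passes to preimages: the image in L of an ideal of a subalgebra is not an
   ideal of L. *)
Definition gap_separated (K : numFieldType) (L : banachLieType K) (P : set L) :=
  forall Z : set L, ~ Z `<=` P -> exists V W : set L,
  [/\ closed_lie_ideal V /\ closed_lie_ideal W, P `<=` W, Z `<=` V, ~ Z `<=` W &
      exists n, dim_quotient V W n].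

(** * Closed ideals and complete chains *)

Section closed_lie_ideal_theory.
Context {K : numFieldType} {L : banachLieType K}.
Implicit Types (P V W Z : set L) (C F : set (set L)).

Lemma closed_lie_idealT : closed_lie_ideal [set: L].
Proof. by split=> //; split=> //; exact: closedT. Qed.

Lemma closed_lie_ideal_bigcap F : (forall Y, F Y -> closed_lie_ideal Y) ->
  closed_lie_ideal (fam_cap F).
Proof.
move=> FI; split; first split; first split.
- by move=> Y /FI[[[]]].
- by move=> a x y Fx Fy Y FY; apply: (FI _ FY).1.1.2; [exact: Fx|exact: Fy].
- by apply: closed_bigI => Y /FI[[]].
- by move=> x y Fy Y FY; apply: (FI _ FY).2; exact: Fy.
Qed.

Lemma closed_lie_idealI V W :
  closed_lie_ideal V -> closed_lie_ideal W -> closed_lie_ideal (V `&` W).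
Proof.
move=> [[sV cV] lV] [[sW cW] lW]; split; first split.
- exact: is_subspaceI.
- exact: closedI.
- by move=> x y [Vy Wy]; split; [exact: lV|exact: lW].
Qed.

Lemma fam_span_sup F Y : F Y -> Y `<=` fam_span F.
Proof.
move=> FY; apply: subset_trans (@subset_closure _ _).
by move=> y Yy X [_]; apply; exists Y.
Qed.

Lemma fam_span_sub F Y : closed_subspace Y -> (forall X, F X -> X `<=` Y) ->
  fam_span F `<=` Y.
Proof.
move=> [sY /closure_id cY] FY; rewrite cY; apply: closureS.
apply: smallest_sub => //; exact: bigcup_sub.
Qed.

Lemma chain_gap_separated C I : complete_lfg_chain C -> fam_span C = setT ->
  C I -> gap_separated I.
Proof.
move=> [[_ totC] Cideal [pC sC] lfgC] spanC CI Z ZI.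
have CT : C setT by rewrite pC -spanC; right.
pose D := [set X | C X /\ Z `<=` X].
have ZD : Z `<=` fam_cap D by move=> z Zz X [_]; exact.
have CD : C (fam_cap D).
  rewrite pC; left; exists D => //; split; first by exists setT.
  by move=> X [].
(* If the intersection were the least member of the chain, it would lie in [I], and so would [Z]. *)
have [|Y [CY YD [n n0 dimY]]] := lfgC _ CD.
  move=> Dcap; apply: ZI; apply: subset_trans ZD _.
  by rewrite Dcap; exact: bigcap_inf.
have ZY : ~ Z `<=` Y.
  by move=> ZY; case: YD => _; apply; exact: bigcap_inf.
exists (fam_cap D).
have [IY|YI] := totC _ _ CI CY.
  by exists Y; split=> //; [split; exact: Cideal|exists n].
(* Here [Y] lies in [I], and enlarging [Y] to [I] keeps the codimension finite. *)
exists I; split=> //; first by split; exact: Cideal.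
have sub X : C X -> is_subspace X by move=> /Cideal[[]].
apply: (@dim_quotient_preimage _ _ _ idfun _ _ _ _ _
  (sub _ CD) (sub _ CI) (sub _ CY) _ _ dimY) => // x [_]; exact: YI.
Qed.

(** * Descending towers *)

Section tower.
Variables (P : set L) (next : set L -> set L).

(* The transfinite descending orbit of [next] from the whole space, which is
   the intersection of the empty family. *)
Inductive tower : set (set L) :=
| tower_cap F : (forall Y, F Y -> tower Y) -> tower (fam_cap F)
| tower_next Y : tower Y -> tower (next Y).

Hypothesis next_sub : forall Y, next Y `<=` Y.

Lemma towerT : tower setT.
Proof.
have -> : [set: L] = fam_cap set0 by rewrite /fam_cap bigcap_set0.
by apply: tower_cap.
Qed.

(** The auxiliary property of the Bourbaki-Witt argument: one application of [next] cannot jump over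
    [Y]. It yields comparability with [Y], and is then shown for every member. *)
Let extreme Y := forall X, tower X -> Y `<=` X -> X <> Y -> Y `<=` next X.

Let extreme_cmp Y X :
  extreme Y -> tower X -> X `<=` next Y \/ Y `<=` X.
Proof.
move=> exY; elim=> {X} [F FT IH|X TX [XY|YX]].
- have [[X FX XY]|noX] := pselect (exists2 X, F X & X `<=` next Y).
    by left; apply: subset_trans XY; exact: bigcap_inf.
  right=> y Yy X FX; have [XY|YX] := IH _ FX; last exact: YX.
  by case: noX; exists X.
- by left; apply: subset_trans XY; exact: next_sub.
- have [->|XY] := pselect (X = Y); first by left.
  by right; exact: exY.
Qed.

Let tower_extreme Y : tower Y -> extreme Y.
Proof.
elim=> {Y} [F FT IH|Y TY exY] X TX.
  move=> FX XF.
  have [Y FY XY] : exists2 Y, F Y & ~ X `<=` Y.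
    apply: contrapT => noY; apply: XF; apply/seteqP; split=> // x Xx Y FY.
    apply: contrapT => Yx; apply: noY; exists Y => // XY; exact/Yx/XY.
  have [XnY|YX] := extreme_cmp (IH _ FY) TX.
    by case: XY; apply: subset_trans XnY _; exact: next_sub.
  apply: (@subset_trans _ Y); first exact: bigcap_inf.
  by apply: IH => // XeY; apply: XY; rewrite XeY.
move=> nYX XnY; have [XnY'|YX] := extreme_cmp exY TX.
  by case: XnY; apply/seteqP.
have [->//|XY] := pselect (X = Y).
by apply: subset_trans (@next_sub _) _; exact: exY.
Qed.

(** More than totality: no member lies strictly between [next Y] and [Y]. *)
Lemma tower_cmp X Y : tower X -> tower Y -> X `<=` next Y \/ Y `<=` X.
Proof. by move=> TX TY; apply: extreme_cmp => //; exact: tower_extreme. Qed.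

Hypothesis nextP : forall Y, closed_lie_ideal Y -> P `<=` Y ->
  closed_lie_ideal (next Y) /\ P `<=` next Y.
Hypothesis next_fix : forall Y, closed_lie_ideal Y -> P `<=` Y ->
  Y `<=` next Y -> Y `<=` P.
Hypothesis next_gap : forall Y, closed_lie_ideal Y -> P `<=` Y ->
  exists n, dim_quotient Y (next Y) n.

Lemma tower_ideal Y : tower Y -> closed_lie_ideal Y /\ P `<=` Y.
Proof.
elim=> {Y} [F _ IH|Y _ [iY PY]]; last exact: nextP.
split; first by apply: closed_lie_ideal_bigcap => Y /IH[].
by move=> x Px Y /IH[_]; exact.
Qed.

Lemma tower_cap_fix F : (forall Y, F Y -> tower Y) ->
  fam_cap F `<=` next (fam_cap F) -> fam_cap F = P.
Proof.
move=> FT Fn; have [iF PF] := tower_ideal (tower_cap FT).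
by apply/seteqP; split=> //; exact: next_fix.
Qed.

(** The intersection of the tower is a member, and so is its image under [next]; it is therefore
    fixed, and only [P] can be. *)
Lemma fam_cap_tower : fam_cap tower = P.
Proof.
apply: tower_cap_fix => //; apply: bigcap_inf.
by apply: tower_next; exact: tower_cap.
Qed.

Lemma fam_span_tower : fam_span tower = setT.
Proof. by apply/seteqP; split=> //; exact: fam_span_sup towerT. Qed.

(** The tower is well-ordered by reverse inclusion: a non-empty subfamily has a greatest member,
    which is its span. The candidate is the least upper bound [fam_cap U]. *)
Lemma fam_span_tower_mem F : F !=set0 -> F `<=` tower -> F (fam_span F).
Proof.
move=> [X0 FX0] FT; pose U := [set Y | tower Y /\ forall X, F X -> X `<=` Y].
have TU : tower (fam_cap U) by apply: tower_cap => Y [].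
have FU X : F X -> X `<=` fam_cap U by move=> FX x Xx Y [_ /(_ _ FX)]; exact.
have FcapU : F (fam_cap U).
  (* Otherwise every member of [F] lies in the [next] of this bound, which is thus an upper bound
     too. The bound is then fixed, so equal to [P], and [X0] is squeezed to [P]. *)
  apply: contrapT => nFU.
  have nU : U (next (fam_cap U)).
    split=> [|X FX]; first exact: tower_next.
    have [//|UX] := tower_cmp (FT _ FX) TU.
    by case: nFU; have <- : X = fam_cap U by apply/seteqP; split=> //; exact: FU.
  have capUP : fam_cap U = P.
    apply: tower_cap_fix => [Y [TY _]//|]; exact: bigcap_inf nU.
  apply: nFU; rewrite capUP; have <- // : X0 = P.
  apply/seteqP; split; first by rewrite -capUP; exact: FU.
  exact: (tower_ideal (FT _ FX0)).2.
suff -> : fam_span F = fam_cap U by [].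
apply/seteqP; split; last exact: fam_span_sup.
by apply: fam_span_sub => //; exact: (tower_ideal TU).1.1.
Qed.

(** Intersections are built into the tower, spans are greatest members, and [next Z] provides the
    gap below [Z]. *)
Lemma tower_complete_lfg_chain : complete_lfg_chain tower.
Proof.
split.
- split; first by exists setT; exact: towerT.
  move=> X Y TX TY; have [XY|] := tower_cmp TX TY; last by right.
  by left; apply: subset_trans XY _; exact: next_sub.
- by move=> Y /tower_ideal[].
- split; apply/seteqP; split=> X.
  + move=> TX; left; exists [set X]; last by rewrite /fam_cap bigcap_set1.
    by split; [exists X|move=> _ ->].
  + case=> [[F [_ FT] <-]|->]; first exact: tower_cap.
    by rewrite fam_span_tower; exact: towerT.
  + move=> TX; left; exists [set X].
      by split; [exists X|move=> _ ->].
    apply/seteqP; split; last exact: fam_span_sup.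
    by apply: fam_span_sub => [|_ ->//]; exact: (tower_ideal TX).1.1.
  + case=> [[F [F0 FT] <-]|->]; last exact: tower_cap.
    exact: FT (fam_span_tower_mem F0 FT).
move=> Z TZ; rewrite fam_cap_tower => ZP.
have [iZ PZ] := tower_ideal TZ.
have nZ : ~ Z `<=` next Z.
  by move=> /(next_fix iZ PZ) ZP'; apply: ZP; apply/seteqP.
exists (next Z); split; [exact: tower_next|by split|].
by have [n dn] := next_gap iZ PZ; exists n => //; exact: dim_quotient_gt0 dn.
Qed.

End tower.

(** Apply separation to [Y] itself: as [Y] lies in [V], its quotient by the intersection with [W]
    embeds in [V] modulo [W]. *)
Lemma gap_separated_lower P Y : closed_lie_ideal Y ->
  gap_separated P -> P `<=` Y -> ~ Y `<=` P ->
  exists X, [/\ closed_lie_ideal X, P `<=` X, X `<=` Y, ~ Y `<=` X &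
    exists n, dim_quotient Y X n].
Proof.
move=> iY sepP PY YP; have [V [W [[iV iW] PW YV YW [n dn]]]] := sepP _ YP.
have iYW := closed_lie_idealI iY iW.
exists (Y `&` W); split=> //.
- by move=> x Px; split; [exact: PY|exact: PW].
- by move=> YYW; apply: YW => y /YYW[].
- apply: (@dim_quotient_preimage _ _ _ idfun _ _ _ _ _ _ _ _ YV _ dn) => //.
  + exact: iY.1.1.
  + exact: iYW.1.1.
  + exact: iW.1.1.
Qed.

Lemma gap_separated_chain P : closed_lie_ideal P -> gap_separated P ->
  exists2 C : set (set L), complete_lfg_chain C & between P setT C.
Proof.
move=> iP sepP.
have /choice[next nextP] : forall Y, exists X, X `<=` Y /\
    (closed_lie_ideal Y -> P `<=` Y ->
     [/\ closed_lie_ideal X, P `<=` X, exists n, dim_quotient Y X n &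
        Y `<=` X -> Y `<=` P]).
  move=> Y; have [h|h] := pselect [/\ closed_lie_ideal Y, P `<=` Y & ~ Y `<=` P].
    case: h => iY PY /(gap_separated_lower iY sepP PY)[X [iX PX XY YX dn]].
    by exists X; split.
  (* Default value: [next] fixes every set that is not a closed ideal strictly above [P]. Among
     closed ideals containing [P] this is only [P], with a gap of dimension 0. *)
  exists Y; split=> // iY PY; split=> //.
    exists 0%N, (fun=> 0); split=> [[]//|c _ []//|z Yz].
    by exists (fun=> 0); rewrite big_ord0 subr0.
  by move=> _; apply: contrapT => YP; exact: h.
have sub Y : next Y `<=` Y := (nextP Y).1.
have tP Y iY PY := (nextP Y).2 iY PY.
have nextP' Y : closed_lie_ideal Y -> P `<=` Y ->
    closed_lie_ideal (next Y) /\ P `<=` next Y.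
  by move=> iY PY; case: (tP Y iY PY).
have next_fix Y : closed_lie_ideal Y -> P `<=` Y -> Y `<=` next Y -> Y `<=` P.
  by move=> iY PY; case: (tP Y iY PY).
exists (tower next).
  apply: (tower_complete_lfg_chain sub nextP' next_fix) => // Y iY PY.
  by case: (tP Y iY PY).
split; last exact: fam_span_tower.
exact: (fam_cap_tower nextP' next_fix).
Qed.

End closed_lie_ideal_theory.

(** * Preimages under contractive Lie homomorphisms *)

Section preimage.
Context {K : numFieldType} {L1 L2 : banachLieType K} (f : {linear L1 -> L2}).
Hypothesis f_contraction : forall x, `|f x| <= `|x|.
Hypothesis f_lie : {morph f : x y / lie x y}.

Lemma closed_lie_ideal_preimage (I : set L2) :
  closed_lie_ideal I -> closed_lie_ideal (f @^-1` I).
Proof.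
move=> [[[I0 Il] cI] lI]; split; first split; first split.
- by rewrite /= linear0.
- by move=> a x y Ix Iy; rewrite /= linearP; exact: Il.
- apply: preimage_closed => // x _; apply/(@cvgrPdist_lt _ L2) => e e0.
  apply/nbhs_ballP; exists e => //= y; rewrite -ball_normE /= => xy.
  by rewrite -linearB; exact: le_lt_trans xy.
- by move=> x y Iy; rewrite /= f_lie; exact: lI.
Qed.

Lemma gap_separated_preimage (P : set L2) :
  gap_separated P -> gap_separated (f @^-1` P).
Proof.
move=> sepP Z ZP.
have [|V [W [[iV iW] PW ZV ZW [n dn]]]] := sepP (f @` Z).
  by move=> fZP; apply: ZP => z Zz; apply: fZP; exists z.
have iV' := closed_lie_ideal_preimage iV.
have iW' := closed_lie_ideal_preimage iW.
exists (f @^-1` V), (f @^-1` W); split=> //.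
- by move=> x; exact: PW.
- by move=> z Zz; apply: ZV; exists z.
- by move=> ZW'; apply: ZW => _ [z Zz <-]; exact: ZW'.
- apply: (dim_quotient_preimage (f := f) iV'.1.1 iW'.1.1 iW.1.1 _ _ dn).
    exact: subset_refl.
  exact: subIsetr.
Qed.

End preimage.

(** * Passage to quotients *)

Section quotient.
Context {R : realType} {L : banachLieType R[i]} (I : closedLieIdeal L).

Lemma quotient_pi_linear : linear (@quotient_pi R L I).
Proof. by move=> a x y; rewrite quotient_piD quotient_piZ. Qed.

HB.instance Definition _ := @GRing.isLinear.Build R[i] L (quotient I) *:%R
  (@quotient_pi R L I) quotient_pi_linear.

Lemma quotient_pi_image (W : set L) x : is_subspace W -> I `<=` W ->
  (@quotient_pi R L I @` W) (quotient_pi I x) <-> W x.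
Proof.
move=> sW IW; split=> [[y Wy /quotient_piP/IW Wyx]|Wx]; last by exists x.
by rewrite -[x](subKr y); exact: is_subspaceB.
Qed.

Lemma closed_lie_ideal_quotient (W : set L) : closed_lie_ideal W -> I `<=` W ->
  closed_lie_ideal (@quotient_pi R L I @` W).
Proof.
move=> [[sW cW] lW] IW; split; first split; first split.
- by exists 0; [exact: is_subspace0|exact: quotient_pi0].
- move=> a _ _ [x Wx <-] [y Wy <-]; exists (a *: x + y); last exact: linearP.
  exact: sW.2.
(* Near the class of [x] there is the class of some [w] in [W]; lifting the small class of [x - w]
   to a small [y] gives a point [x - y] of [W] near [x]. *)
- move=> q; have [x <-] := quotient_pi_surj q => clx.
  apply/(quotient_pi_image _ sW IW)/cW => B /nbhs_ballP[e /= e0 eB].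
  have [_ [[w Ww <-]]] := clx _ (nbhsx_ballx (quotient_pi I x) _ e0).
  rewrite -ball_normE /= -quotient_piB => /quotient_norm_lift[y [yxw ye]].
  exists (x - y); split; last first.
    by apply: eB; rewrite -ball_normE /= opprB addrC subrK.
  move/quotient_piP/IW: yxw => Wywx.
  have -> : x - y = w - (y - (x - w)) by rewrite opprB addrA [w + _]addrC subrK.
  exact: is_subspaceB.
- move=> q _ [y Wy <-]; have [x <-] := quotient_pi_surj q.
  by exists (lie x y); [exact: lW|exact: quotient_pi_lie].
Qed.

Lemma dim_quotient_pi (V W : set L) n : is_subspace W -> I `<=` W ->
  dim_quotient V W n ->
  dim_quotient (@quotient_pi R L I @` V) (@quotient_pi R L I @` W) n.
Proof.
move=> sW IW [e [Ve efree egen]].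
have piE (c : 'I_n -> R[i]) : \sum_(i < n) c i *: quotient_pi I (e i) =
    quotient_pi I (\sum_(i < n) c i *: e i).
  by rewrite linear_sum; apply: eq_bigr => i _; rewrite linearZ.
exists (fun i => quotient_pi I (e i)); split=> [i|c|_ [v Vv <-]].
- by exists (e i).
- by rewrite piE => /(quotient_pi_image _ sW IW); exact: efree.
- have [c Wc] := egen v Vv; exists c; rewrite piE -quotient_piB.
  exact/(quotient_pi_image _ sW IW).
Qed.

Lemma gap_separated_quotient :
  gap_separated I <-> gap_separated [set 0 : quotient I].
Proof.
split=> [sepI Z Z0|sep0].
  (* Adjoining 0 makes the preimage contain [I]; hence so does [V], and its image is a closed
     ideal. *)
  pose Z' := @quotient_pi R L I @^-1` (Z `|` [set 0]).
  have [|V [W [[iV iW] IW ZV ZW [n dn]]]] := sepI Z'.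
    move=> Z'I; apply: Z0 => q; have [x <-] := quotient_pi_surj q => Zx.
    have /Z'I Ix : Z' x by left.
    by rewrite /= -quotient_pi0; apply/quotient_piP; rewrite subr0.
  have IV : I `<=` V.
    move=> x Ix; apply: ZV; right.
    by rewrite /= -quotient_pi0; apply/quotient_piP; rewrite subr0.
  exists (@quotient_pi R L I @` V), (@quotient_pi R L I @` W); split.
  - by split; exact: closed_lie_ideal_quotient.
  - by move=> _ ->; exists 0; [exact: is_subspace0 iW.1.1|exact: quotient_pi0].
  - move=> q; have [x <-] := quotient_pi_surj q => Zx.
    by exists x => //; apply: ZV; left.
  - move=> ZW'; apply: ZW => x [/ZW'|/= x0].
      by move=> /(quotient_pi_image _ iW.1.1 IW).
    by apply: IW; rewrite -[x]subr0; apply/quotient_piP; rewrite quotient_pi0.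
  - by exists n; exact: dim_quotient_pi iW.1.1 IW dn.
have := gap_separated_preimage (@quotient_norm_pi R L I)
  (@quotient_pi_lie R L I) sep0.
suff -> : @quotient_pi R L I @^-1` [set 0] = I by [].
by apply/seteqP; split=> x /=; rewrite -(quotient_pi0 I) quotient_piP subr0.
Qed.

End quotient.

(** * Strongly F-absorbing ideals *)

Lemma closed_lie_ideal0 (K : numFieldType) (L : banachLieType K) :
  closed_lie_ideal [set 0 : L].
Proof.
split; first split; first split=> //.
- by move=> a x y -> ->; rewrite /= scaler0 addr0.
- apply: accessible_closed_set1; apply: hausdorff_accessible.
  exact: norm_hausdorff.
- by move=> x _ ->; have := lieZr 0 x 0; rewrite !scale0r.
Qed.

Lemma strongly_F_absorbingP (R : realType) (L : banachLieType R[i]) (I : set L) :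
  strongly_F_absorbing I <-> closed_lie_ideal I /\ gap_separated I.
Proof.
split=> [[iI [C Cch [capC spanC]]]|[iI sepI]].
  split=> //; apply/(gap_separated_quotient (ClosedLieIdeal iI)).
  apply: (chain_gap_separated Cch spanC).
  (* The zero ideal, being the intersection of the chain, belongs to it by s-completeness. *)
  by have [_ _ [_ ->] _] := Cch; right.
exists iI; apply: gap_separated_chain; first exact: closed_lie_ideal0.
exact/(gap_separated_quotient (ClosedLieIdeal iI)).
Qed.

Lemma commutative_gap_separated0 (R : realType) (L : banachLieType R[i]) :
  (forall x y : L, lie x y = 0) -> gap_separated [set 0 : L].
Proof.
move=> abL Z Z0; have [z Zz z0] : exists2 z, Z z & z != 0.
  apply: contrapT => noz; apply: Z0 => z Zz; apply: contrapT => /eqP z0.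
  by apply: noz; exists z.
have [W [cW Wz dW]] := closed_hyperplane_avoiding z0.
exists setT, W; split=> //.
- split; first exact: closed_lie_idealT.
  by split=> // x y _; rewrite abL; exact: is_subspace0 cW.1.
- by move=> _ ->; exact: is_subspace0 cW.1.
- by move=> ZW; exact/Wz/ZW.
- by exists 1%N.
Qed.

Section strongly_F_absorbing_theory.
Context {R : realType} {L : banachLieType R[i]}.
Implicit Types (I J : set L) (C F : set (set L)).

(** A set inside [I] is separated by the pair [I], [J]; any other set by a pair that [I]
    provides. *)
Lemma strongly_F_absorbing_finite_codim I J : closed_lie_ideal J -> J `<=` I ->
  (exists n, dim_quotient I J n) ->
  strongly_F_absorbing I -> strongly_F_absorbing J.
Proof.
move=> iJ JI dIJ /strongly_F_absorbingP[iI sepI].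
apply/strongly_F_absorbingP; split=> // Z ZJ.
have [ZI|/sepI[V [W [iVW IW ZV ZW dn]]]] := pselect (Z `<=` I).
  by have [n dn] := dIJ; exists I, J; split=> //; exists n.
by exists V, W; split=> //; exact: subset_trans IW.
Qed.

Lemma strongly_F_absorbing_chain C I : complete_lfg_chain C ->
  fam_span C = setT -> C I -> strongly_F_absorbing I.
Proof.
move=> Cch spanC CI; apply/strongly_F_absorbingP; split.
  by case: Cch => _ /(_ _ CI).
exact: chain_gap_separated Cch spanC CI.
Qed.

Lemma strongly_F_absorbing_cap F :
  F `<=` Abs_Fs L -> strongly_F_absorbing (fam_cap F).
Proof.
move=> FA; apply/strongly_F_absorbingP; split.
  by apply: closed_lie_ideal_bigcap => Y /FA/strongly_F_absorbingP[].
move=> Z ZF; have [Y FY ZY] : exists2 Y, F Y & ~ Z `<=` Y.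
  apply: contrapT => noY; apply: ZF => z Zz Y FY.
  by apply: contrapT => Yz; apply: noY; exists Y => // ZY; exact/Yz/ZY.
have /strongly_F_absorbingP[_ sepY] := FA _ FY.
have [V [W [iVW YW ZV ZW dn]]] := sepY _ ZY.
by exists V, W; split=> //; apply: subset_trans YW; exact: bigcap_inf.
Qed.

End strongly_F_absorbing_theory.

Theorem lemma8p19 (R : realType) (L : banachLieType R[i]) :
  (* (i) *)
  (forall I : set L, closed_lie_ideal I ->
     (strongly_F_absorbing I <->
      exists2 C : set (set L), complete_lfg_chain C & between I setT C))
  /\ (* (ii) *)
  (forall I J : set L, closed_lie_ideal I -> closed_lie_ideal J -> J `<=` I ->
     (exists n : nat, dim_quotient I J n) ->
     strongly_F_absorbing I -> strongly_F_absorbing J)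
  /\ (* (iii) *)
  (forall C : set (set L), complete_lfg_chain C -> fam_span C = setT ->
     forall I : set L, C I -> strongly_F_absorbing I)
  /\ (* (iv) *)
  [/\ p_complete (Abs_Fs L),
      lower_finite_gap (Abs_Fs L),
      fam_span (Abs_Fs L) = setT,
      strongly_F_absorbing (Fs L) &
      forall I : set L, strongly_F_absorbing I -> Fs L `<=` I]
  /\ (* (v) *)
  (forall (M : closedLieSubalgebra L) (I : set L), Abs_Fs L I ->
     Abs_Fs (subalgebra M) [set x : subalgebra M | I (subalgebra_val x)])
  /\ (* (vi) *)
  ((forall x y : L, lie x y = 0) -> Fs L = [set 0]).
Proof.
have absorbingT : strongly_F_absorbing [set: L].
  by apply/strongly_F_absorbingP; split; [exact: closed_lie_idealT|move=> Z []].
have spanA : fam_span (Abs_Fs L) = setT.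
  by apply/seteqP; split=> //; exact: fam_span_sup absorbingT.
have FsA : strongly_F_absorbing (Fs L) by exact: strongly_F_absorbing_cap.
have Fs_min I : strongly_F_absorbing I -> Fs L `<=` I.
  by move=> AI; exact: bigcap_inf.
split.
  move=> I iI; split=> [/strongly_F_absorbingP[_ sepI]|[C Cch [capC spanC]]].
    exact: gap_separated_chain.
  apply: (strongly_F_absorbing_chain Cch spanC); rewrite -capC.
  by have [_ _ [_ sC] _] := Cch; rewrite [X in X _]sC; right.
split.
  by move=> I J _; exact: strongly_F_absorbing_finite_codim.
split; first by move=> C Cch spanC I; exact: strongly_F_absorbing_chain.
split.
  split=> //.
    apply/seteqP; split=> X.
      move=> AX; left; exists [set X]; last by rewrite /fam_cap bigcap_set1.
      by split; [exists X|move=> _ ->].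
    by case=> [[F [_ FA] <-]|->]; [exact: strongly_F_absorbing_cap|rewrite spanA].
  move=> Z AZ ZF; have /strongly_F_absorbingP[iZ _] := AZ.
  have /strongly_F_absorbingP[_ sepF] := FsA.
  have ZnF : ~ Z `<=` Fs L.
    by move=> ZF'; apply: ZF; apply/seteqP; split=> //; exact: Fs_min.
  (* Separation from the least absorbing ideal yields [Y] of finite codimension in [Z]; it is
     absorbing by (ii). *)
  have [Y [iY FY YZ ZY [n dn]]] :=
    gap_separated_lower iZ sepF (Fs_min _ AZ) ZnF.
  exists Y; split; [|by split|by exists n => //; exact: dim_quotient_gt0 dn].
  by apply: strongly_F_absorbing_finite_codim AZ => //; exists n.
split.
  move=> M I /strongly_F_absorbingP[iI sepI]; apply/strongly_F_absorbingP.
  (* The inclusion of [M] is a contractive Lie homomorphism, and the set in question is the preimage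
     of [I]. *)
  have val_contr (x : subalgebra M) : `|val x| <= `|x| by [].
  have val_lie : {morph (val : subalgebra M -> L) : x y / lie x y}.
    exact: subalgebra_lieE.
  split; first exact: closed_lie_ideal_preimage val_contr val_lie _ iI.
  exact: gap_separated_preimage val_contr val_lie _ sepI.
move=> abL; apply/seteqP; split; last first.
  by move=> _ -> Y /strongly_F_absorbingP[[[[Y0 _] _] _] _].
apply: Fs_min; apply/strongly_F_absorbingP; split; first exact: closed_lie_ideal0.
exact: commutative_gap_separated0.
Qed.
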